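(* Let $m \ge 2$, $r \ge 0$ and let $\Phi_r$ be the free solvable group on $m$ generators of solvability length $r$. For $n \in \mathbb{N}$ let $\pi_{r,n} : \Phi_r \to \Phi_{r,n}$ be the natural homomorphism. Then every finite quotient $\pi : \Phi_r \to G$ (i.e. surjective homomorphism onto a finite group $G$) whose order $|G|$ divides $n$ factors through $\Phi_{r,n}$: there is a homomorphism $\tilde{\pi} : \Phi_{r,n} \to G$ with $\tilde{\pi} \circ \pi_{r,n} = \pi$. In particular, the profinite completion of $\Phi_r$ satisfies $\hat{\Phi}_r \cong \varprojlim_{n \in \mathbb{N}} \Phi_{r,n}$.
   Context: Let $F$ be the free group on $m$ generators. Put $F^{(0)} = F$, $F^{(r+1)} = [F^{(r)}, F^{(r)}]$, and $\Phi_r = F/F^{(r)}$. For $n \in \mathbb{N} = \{1,2,\dots\}$ define inductively $K_{0,n} := F$ and $K_{r+1,n} := [K_{r,n},K_{r,n}]\,(K_{r,n})^n$, where $H^n$ denotes the subgroup generated by the $n$-th powers of the elements of $H$. Put $\Phi_{r,n} := F/K_{r,n}$. One has $F^{(r)} \le K_{r,n}$, so there is a natural surjection $\Phi_r \to \Phi_{r,n}$. If $n \mid n'$ then $K_{r,n'} \le K_{r,n}$; the inverse limit is over $\mathbb{N}$ ordered by divisibility with the natural surjections $\Phi_{r,n'} \to \Phi_{r,n}$. *)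

(* Defs.v *)
From HB Require Import structures.
From Stdlib Require Import Relation_Operators.
From mathcomp Require Import all_boot.
From mathcomp Require Import all_classical.
From mathcomp Require Import topology.

Set Implicit Arguments.
Unset Strict Implicit.
Unset Printing Implicit Defensive.

Import Algebra.
Local Open Scope classical_set_scope.
Local Open Scope quotient_scope.
Local Open Scope group_scope.

Record normalSubgroup (G : groupType) := NormalSubgroup {
  nset :> set G;
  nset1 : nset 1;
  nsetM : forall x y, nset x -> nset y -> nset (x * y);
  nsetV : forall x, nset x -> nset x^-1;
  nsetJ : forall x y, nset x -> nset (x ^ y)
}.

Section Quotient.
Variables (G : groupType) (N : normalSubgroup G).

Definition coset_eq : rel G := fun x y => `[< nset N (x^-1 * y) >].

Lemma coset_eqxx : reflexive coset_eq.
Proof. by move=> x; apply/asboolP; rewrite mulVg; exact: nset1. Qed.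

Lemma coset_eq_sym : symmetric coset_eq.
Proof.
have H x y : coset_eq x y -> coset_eq y x.
  move=> /asboolP Nxy; apply/asboolP.
  by rewrite -[x in X in nset N X]invgK -invgM; exact: nsetV.
by move=> x y; apply/idP/idP; exact: H.
Qed.

Lemma coset_eq_trans : transitive coset_eq.
Proof.
move=> y x z /asboolP Nxy /asboolP Nyz; apply/asboolP.
by have := nsetM Nxy Nyz; rewrite mulgA mulgK.
Qed.

Canonical coset_equiv := EquivRel coset_eq coset_eqxx coset_eq_sym coset_eq_trans.

Definition quotientGroup := {eq_quot coset_equiv}.
HB.instance Definition _ := Choice.on quotientGroup.

Definition qproj (x : G) : quotientGroup := \pi_{eq_quot coset_equiv} x.
Definition qrepr (c : quotientGroup) : G := repr c.

Lemma qreprK : cancel qrepr qproj.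
Proof. exact: reprK. Qed.

Lemma qprojP x y : qproj x = qproj y <-> nset N (x^-1 * y).
Proof.
split=> [/eqP|Nxy]; first by rewrite /qproj eqmodE => /asboolP.
by apply/eqP; rewrite /qproj eqmodE; apply/asboolP.
Qed.

Lemma qrepr_qproj x : nset N ((qrepr (qproj x))^-1 * x).
Proof. by apply/qprojP; rewrite qreprK. Qed.

Definition qone : quotientGroup := qproj 1.
Definition qmul (c d : quotientGroup) := qproj (qrepr c * qrepr d).
Definition qinv (c : quotientGroup) := qproj (qrepr c)^-1.

Lemma qmulE x y : qmul (qproj x) (qproj y) = qproj (x * y).
Proof.
apply/qprojP; rewrite invgM.
set b := qrepr (qproj y); set a := qrepr (qproj x).
have -> : b^-1 * a^-1 * (x * y) = (a^-1 * x) ^ b * (b^-1 * y).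
  by rewrite /conjg !mulgA mulgK.
by apply: nsetM; [apply: nsetJ|]; exact: qrepr_qproj.
Qed.

Lemma qinvE x : qinv (qproj x) = qproj x^-1.
Proof.
apply/qprojP; rewrite invgK; set a := qrepr _.
have -> : a * x^-1 = ((a^-1 * x)^-1) ^ a^-1.
  by rewrite /conjg invgM !invgK -mulgA mulgV mulg1.
by apply/nsetJ/nsetV; exact: qrepr_qproj.
Qed.

Lemma qmulA : associative qmul.
Proof.
move=> c d e; rewrite -(qreprK c) -(qreprK d) -(qreprK e).
by rewrite !qmulE mulgA.
Qed.
Lemma qmul1 : left_id qone qmul.
Proof. by move=> c; rewrite -(qreprK c) qmulE mul1g. Qed.
Lemma qmulr1 : right_id qone qmul.
Proof. by move=> c; rewrite -(qreprK c) qmulE mulg1. Qed.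
Lemma qmulV : left_inverse qone qinv qmul.
Proof. by move=> c; rewrite -(qreprK c) qinvE qmulE mulVg. Qed.
Lemma qmulrV : right_inverse qone qinv qmul.
Proof. by move=> c; rewrite -(qreprK c) qinvE qmulE mulgV. Qed.

HB.instance Definition _ :=
  isGroup.Build quotientGroup qmulA qmul1 qmulr1 qmulV qmulrV.

Lemma qproj_mulg : {morph qproj : x y / x * y}.
Proof. by move=> x y; rewrite [RHS]qmulE. Qed.

HB.instance Definition _ :=
  isMultiplicative.Build G quotientGroup qproj qproj_mulg.

End Quotient.

Section QuotientMap.
Variables (G : groupType) (N M : normalSubgroup G) (NM : N `<=` M).

Definition qmap of N `<=` M :=
  fun c : quotientGroup N => qproj M (qrepr c).

Lemma qmapE x : qmap NM (qproj N x) = qproj M x.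
Proof. by apply/qprojP/NM; exact: qrepr_qproj. Qed.

Lemma qmap_mulg : {morph qmap NM : c d / c * d}.
Proof.
move=> c d; rewrite -(qreprK c) -(qreprK d).
by rewrite -qproj_mulg !qmapE qproj_mulg.
Qed.

HB.instance Definition _ := isMultiplicative.Build
  (quotientGroup N) (quotientGroup M) (qmap NM) qmap_mulg.

End QuotientMap.

Definition is_subgroup (G : groupType) (H : set G) :=
  [/\ H 1, forall x y, H x -> H y -> H (x * y) & forall x, H x -> H x^-1].

Definition generated (G : groupType) (A : set G) : set G :=
  \bigcap_(H in [set H | is_subgroup H /\ A `<=` H]) H.

Section Verbal.
Variable G : groupType.
Implicit Types (A B : set G) (N M : normalSubgroup G).

Lemma generated_subgroup A : is_subgroup (generated A).
Proof.
split=> [H [[]]//|x y Ax Ay H HA|x Ax H HA]; have [[_ HM HV] _] := HA.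
- by apply: HM; [exact: Ax | exact: Ay].
- by apply: HV; exact: Ax.
Qed.

Lemma sub_generated A : A `<=` generated A.
Proof. by move=> x Ax H [_]; exact. Qed.

Lemma generated_min A (H : set G) :
  is_subgroup H -> A `<=` H -> generated A `<=` H.
Proof. by move=> sH AH x; apply. Qed.

Lemma generated_conj A : (forall x y, A x -> A (x ^ y)) ->
  forall x y, generated A x -> generated A (x ^ y).
Proof.
move=> AJ x y; have [g1 gM gV] := generated_subgroup A.
apply: (generated_min (H := [set z | generated A (z ^ y)])).
- split=> [|u v|u] /=; rewrite ?conj1g ?conjMg ?conjVg//; [exact: gM|exact: gV].
- by move=> z Az; exact: sub_generated (AJ _ _ Az).
Qed.

Definition generatedN A (AJ : forall x y, A x -> A (x ^ y)) :
    normalSubgroup G :=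
  @NormalSubgroup G (generated A)
    (let: And3 g1 _ _ := generated_subgroup A in g1)
    (let: And3 _ gM _ := generated_subgroup A in gM)
    (let: And3 _ _ gV := generated_subgroup A in gV)
    (generated_conj AJ).

Definition fullN : normalSubgroup G :=
  @NormalSubgroup G setT I (fun _ _ _ _ => I) (fun _ _ => I) (fun _ _ _ => I).

Definition commutators (H : set G) : set G :=
  [set z | exists x y, [/\ H x, H y & z = [~ x, y]]].

Definition powers (H : set G) (n : nat) : set G :=
  [set x ^+ n | x in H].

Lemma commutators_conj N x y : commutators N x -> commutators N (x ^ y).
Proof.
move=> [a [b [Na Nb ->]]]; exists (a ^ y), (b ^ y).
by split; [exact: nsetJ | exact: nsetJ | rewrite conjRg].
Qed.

Lemma powers_conj N n x y : powers N n x -> powers N n (x ^ y).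
Proof. by move=> [a Na <-]; exists (a ^ y); [exact: nsetJ | rewrite conjXg]. Qed.

Definition commutatorN N : normalSubgroup G :=
  generatedN (@commutators_conj N).

Definition powerN N n : normalSubgroup G :=
  generatedN (@powers_conj N n).

Definition mulN_set N M : set G :=
  [set z | exists x y, [/\ nset N x, nset M y & z = x * y]].

Section MulN.
Variables N M : normalSubgroup G.

Lemma mulN1 : mulN_set N M 1.
Proof.
by exists 1, 1; split; [exact: nset1 | exact: nset1 | rewrite mulg1].
Qed.

Lemma mulNM x y : mulN_set N M x -> mulN_set N M y -> mulN_set N M (x * y).
Proof.
move=> [a [b [Na Mb ->]]] [c [d [Nc Md ->]]].
exists (a * c), (b ^ c * d); split.
- exact: nsetM.
- by apply: nsetM => //; exact: nsetJ.
- by rewrite /conjg !mulgA mulgK.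
Qed.

Lemma mulNV x : mulN_set N M x -> mulN_set N M x^-1.
Proof.
move=> [a [b [Na Mb ->]]]; exists a^-1, (b^-1 ^ a^-1).
split; [exact: nsetV | by apply/nsetJ/nsetV |].
by rewrite /conjg invgK invgM !mulgA mulVg mul1g.
Qed.

Lemma mulNJ x y : mulN_set N M x -> mulN_set N M (x ^ y).
Proof.
move=> [a [b [Na Mb ->]]]; exists (a ^ y), (b ^ y).
by rewrite conjMg; split=> //; exact: nsetJ.
Qed.

Definition mulN : normalSubgroup G := NormalSubgroup mulN1 mulNM mulNV mulNJ.
End MulN.

(* [derived r] is G^(r). *)
Fixpoint derived (r : nat) : normalSubgroup G :=
  if r is r'.+1 then commutatorN (derived r') else fullN.

(* [Kseries r n] is K_{r,n}. *)
Fixpoint Kseries (r n : nat) : normalSubgroup G :=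
  if r is r'.+1 then mulN (commutatorN (Kseries r' n)) (powerN (Kseries r' n) n)
  else fullN.

Lemma commutatorNS N M : N `<=` M -> commutatorN N `<=` commutatorN M.
Proof.
move=> NM; apply: generated_min.
  exact: generated_subgroup.
move=> _ [x [y [Nx Ny ->]]]; apply: sub_generated.
by exists x, y; split=> //; exact: NM.
Qed.

Lemma powerNS N M n n' :
  (n %| n')%N -> N `<=` M -> powerN N n' `<=` powerN M n.
Proof.
move=> /dvdnP[k ->] NM; apply: generated_min.
  exact: generated_subgroup.
move=> _ [x Nx <-]; apply: sub_generated; exists (x ^+ k).
  by elim: k => [|k IH]; [exact: nset1 | rewrite expgS; apply: nsetM; [exact: NM|]].
by rewrite -expgnA.
Qed.

Lemma mulNS N N' M M' : N `<=` N' -> M `<=` M' -> mulN N M `<=` mulN N' M'.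
Proof.
by move=> NN' MM' _ [x [y [/NN' Nx /MM' My ->]]]; exists x, y.
Qed.

Lemma derived_sub_Kseries r n : derived r `<=` Kseries r n.
Proof.
elim: r => [//|r IH] x /= /(commutatorNS IH) Cx.
by exists x, 1; split=> //; [exact: nset1 | rewrite mulg1].
Qed.

Lemma KseriesS r n n' : (n %| n')%N -> Kseries r n' `<=` Kseries r n.
Proof.
move=> nn'; elim: r => [//|r IH] /=.
by apply: mulNS; [exact: commutatorNS | exact: powerNS].
Qed.

End Verbal.

Section FreeGroup.
Variable T : choiceType.

(* The letter [(t, true)] stands for t and [(t, false)] for its inverse. *)
Definition letter := (T * bool)%type.
Definition letterV (a : letter) : letter := (a.1, ~~ a.2).
Definition word := seq letter.
Definition wordV (w : word) : word := rev (map letterV w).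

Inductive cancel_step : word -> word -> Prop :=
  CancelStep u a v : cancel_step (u ++ [:: a; letterV a] ++ v) (u ++ v).

Definition free_equiv : word -> word -> Prop := clos_refl_sym_trans word cancel_step.

Definition free_eq : rel word := fun u v => `[< free_equiv u v >].

Lemma free_eqxx : reflexive free_eq.
Proof. by move=> u; apply/asboolP; exact: rst_refl. Qed.
Lemma free_eq_sym : symmetric free_eq.
Proof. by move=> u v; apply/asboolP/asboolP; exact: rst_sym. Qed.
Lemma free_eq_trans : transitive free_eq.
Proof.
by move=> v u w /asboolP uv /asboolP vw; apply/asboolP; exact: rst_trans uv vw.
Qed.

Canonical free_equivRel := EquivRel free_eq free_eqxx free_eq_sym free_eq_trans.

Definition freeGroup := {eq_quot free_equivRel}.
HB.instance Definition _ := Choice.on freeGroup.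

Definition fclass (w : word) : freeGroup := \pi_{eq_quot free_equivRel} w.
Definition frepr (c : freeGroup) : word := repr c.

Lemma freprK : cancel frepr fclass.
Proof. exact: reprK. Qed.

Lemma fclassP u v : fclass u = fclass v <-> free_equiv u v.
Proof.
split=> [/eqP|uv]; first by rewrite /fclass eqmodE => /asboolP.
by apply/eqP; rewrite /fclass eqmodE; apply/asboolP.
Qed.

Lemma free_equiv_ctx p q u v :
  free_equiv u v -> free_equiv (p ++ u ++ q) (p ++ v ++ q).
Proof.
elim=> {u v} [_ _ [u a v]|u|u v _|u v w _ uv _]; last exact: rst_trans.
- apply: rst_step; have := CancelStep (p ++ u) a (v ++ q).
  by rewrite -!catA.
- exact: rst_refl.
- exact: rst_sym.
Qed.

Lemma free_equiv_cat u u' v v' :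
  free_equiv u u' -> free_equiv v v' -> free_equiv (u ++ v) (u' ++ v').
Proof.
move=> uu' vv'; apply: (rst_trans _ _ _ (u' ++ v)).
  exact: (free_equiv_ctx [::] v uu').
by have := free_equiv_ctx u' [::] vv'; rewrite !cats0.
Qed.

Lemma letterVK : involutive letterV.
Proof. by case=> t b; rewrite /letterV /= negbK. Qed.

Lemma wordV_cat u v : wordV (u ++ v) = wordV v ++ wordV u.
Proof. by rewrite /wordV map_cat rev_cat. Qed.

Lemma wordVK : involutive wordV.
Proof.
by move=> w; rewrite /wordV map_rev revK -map_comp map_id_in // => a _ /=; exact: letterVK.
Qed.

Lemma free_equivV u v : free_equiv u v -> free_equiv (wordV u) (wordV v).
Proof.
elim=> {u v} [_ _ [u a v]|u|u v _|u v w _ uv _]; last exact: rst_trans.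
- apply: rst_step; rewrite !wordV_cat -catA.
  have -> : wordV [:: a; letterV a] = [:: a; letterV a].
    by rewrite /wordV /= letterVK.
  exact: CancelStep.
- exact: rst_refl.
- exact: rst_sym.
Qed.

Lemma free_equiv_mulV w : free_equiv (w ++ wordV w) [::].
Proof.
elim: w => [|a w IH]; first exact: rst_refl.
have -> : (a :: w) ++ wordV (a :: w) = [:: a] ++ (w ++ wordV w) ++ [:: letterV a].
  by rewrite -[a :: w]cat1s wordV_cat !catA.
apply: rst_trans (free_equiv_ctx [:: a] [:: letterV a] IH) _.
exact/rst_step/(CancelStep [::] a [::]).
Qed.

Definition fone : freeGroup := fclass [::].
Definition fmul (c d : freeGroup) := fclass (frepr c ++ frepr d).
Definition finv (c : freeGroup) := fclass (wordV (frepr c)).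

Lemma fmulE u v : fmul (fclass u) (fclass v) = fclass (u ++ v).
Proof. by apply/fclassP/free_equiv_cat; apply/fclassP; rewrite freprK. Qed.

Lemma finvE u : finv (fclass u) = fclass (wordV u).
Proof. by apply/fclassP/free_equivV/fclassP; rewrite freprK. Qed.

Lemma fmulA : associative fmul.
Proof.
move=> c d e; rewrite -(freprK c) -(freprK d) -(freprK e).
by rewrite !fmulE catA.
Qed.
Lemma fmul1 : left_id fone fmul.
Proof. by move=> c; rewrite -(freprK c) fmulE. Qed.
Lemma fmulr1 : right_id fone fmul.
Proof. by move=> c; rewrite -(freprK c) fmulE cats0. Qed.
Lemma fmulrV : right_inverse fone finv fmul.
Proof.
move=> c; rewrite -(freprK c) finvE fmulE.
by apply/fclassP; exact: free_equiv_mulV.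
Qed.
Lemma fmulV : left_inverse fone finv fmul.
Proof.
move=> c; rewrite -(freprK c) finvE fmulE; apply/fclassP.
by have := free_equiv_mulV (wordV (frepr c)); rewrite wordVK.
Qed.

HB.instance Definition _ :=
  isGroup.Build freeGroup fmulA fmul1 fmulr1 fmulV fmulrV.

Definition fgen (t : T) : freeGroup := fclass [:: (t, true)].

Section Lift.
Variables (G : groupType) (f : T -> G).

Definition eval_letter (a : letter) : G := if a.2 then f a.1 else (f a.1)^-1.
Definition eval_word (w : word) : G := foldr (fun a x => eval_letter a * x) 1 w.

Lemma eval_word_cat u v : eval_word (u ++ v) = eval_word u * eval_word v.
Proof.
by elim: u => [|a u IH] /=; rewrite ?mul1g // IH mulgA.
Qed.

Lemma eval_word_equiv u v : free_equiv u v -> eval_word u = eval_word v.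
Proof.
elim=> {u v} [_ _ [u [t b] v]|//|u v _ ->//|u v w _ -> _ ->//].
rewrite !eval_word_cat /= /eval_letter /= mulg1.
by case: b; rewrite /= ?mulgV ?mulVg mul1g.
Qed.

Definition flift (c : freeGroup) : G := eval_word (frepr c).

Lemma fliftE w : flift (fclass w) = eval_word w.
Proof. by apply/eval_word_equiv/fclassP; rewrite freprK. Qed.

Lemma flift_mulg : {morph flift : c d / c * d}.
Proof.
move=> c d; rewrite -(freprK c) -(freprK d).
by rewrite [_ * _]fmulE !fliftE eval_word_cat.
Qed.

HB.instance Definition _ := isMultiplicative.Build freeGroup G flift flift_mulg.

End Lift.

(* The universal property, which characterizes [freeGroup] with basis [fgen]. *)
Lemma freeGroup_universal (G : groupType) (f : T -> G) :
  exists2 h : {multiplicative freeGroup -> G}, (forall t, h (fgen t) = f t) &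
    forall h' : {multiplicative freeGroup -> G},
      (forall t, h' (fgen t) = f t) -> h' =1 h.
Proof.
exists (flift f : {multiplicative freeGroup -> G}).
  by move=> t; rewrite [LHS]fliftE /= /eval_letter mulg1.
move=> h' h'f c; rewrite -(freprK c) [RHS]fliftE.
have h'1 : h' 1 = 1.
  by apply: (mulgI (h' 1)); rewrite -gmulfM !mulg1.
elim: (frepr c) => [//|[t b] w IH] /=; rewrite -IH.
have -> : fclass ((t, b) :: w) = fclass [:: (t, b)] * fclass w.
  by rewrite [RHS]fmulE.
rewrite gmulfM; congr (_ * _); rewrite /eval_letter /=.
case: b; first exact: h'f.
have -> : fclass [:: (t, false)] = (fgen t)^-1 by rewrite [RHS]finvE.
by apply: (mulgI (h' (fgen t))); rewrite -gmulfM mulgV h'1 h'f mulgV.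
Qed.

End FreeGroup.

HB.mixin Record isTopologicalGroup G of Group G & Topological G := {
  mulg_continuous : continuous (fun p : G * G => p.1 * p.2);
  invg_continuous : continuous (fun x : G => x^-1)
}.

#[short(type="topologicalGroupType")]
HB.structure Definition TopologicalGroup :=
  {G of isTopologicalGroup G & Group G & Topological G}.

Definition topologically_isomorphic (G H : topologicalGroupType) : Prop :=
  exists (f : {multiplicative G -> H}) (g : {multiplicative H -> G}),
    [/\ cancel f g, cancel g f, continuous f & continuous g].

Record inverseSystem := InverseSystem {
  sys_index : Type;
  sys_le : sys_index -> sys_index -> Prop;
  sys_refl : forall i, sys_le i i;
  sys_trans : forall i j k, sys_le i j -> sys_le j k -> sys_le i k;
  sys_directed : forall i j, exists k, sys_le i k /\ sys_le j k;
  sys_obj : sys_index -> groupType;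
  sys_map : forall i j, sys_le i j -> {multiplicative sys_obj j -> sys_obj i};
  sys_map_id : forall i (ii : sys_le i i), sys_map ii =1 id;
  sys_map_comp : forall i j k (ij : sys_le i j) (jk : sys_le j k) (ik : sys_le i k),
    sys_map ij \o sys_map jk =1 sys_map ik
}.

Section InverseLimit.
Variable S : inverseSystem.

Definition sys_product : topologicalType :=
  prod_topology (fun i : sys_index S => discrete_topology (sys_obj i)).

Definition compatible : set sys_product :=
  [set x | forall i j (ij : sys_le i j), sys_map ij (x j) = x i].

(* The compatible families, topologized as a subspace of the product of the
   discrete groups [sys_obj i]. *)
Definition inverseLimit := set_type compatible.
HB.instance Definition _ := Topological.on inverseLimit.

Definition lim_proj (i : sys_index S) (x : inverseLimit) : sys_obj i :=
  set_val x i.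

Lemma lim_ext (x y : inverseLimit) :
  (forall i, lim_proj i x = lim_proj i y) -> x = y.
Proof. by move=> xy; apply: val_inj; apply: functional_extensionality_dep. Qed.

Lemma lim_projP (x : inverseLimit) i j (ij : sys_le i j) :
  sys_map ij (lim_proj j x) = lim_proj i x.
Proof. by have /set_mem := valP x; apply. Qed.

Definition lim_mk (x : forall i : sys_index S, sys_obj i)
    (xP : forall i j (ij : sys_le i j), sys_map ij (x j) = x i) : inverseLimit :=
  SigSub (mem_set (xP : compatible x)).

Lemma sys_map1 i j (ij : @sys_le S i j) : sys_map ij 1 = 1.
Proof. by apply: (mulgI (sys_map ij 1)); rewrite -gmulfM !mulg1. Qed.

Lemma sys_mapV i j (ij : @sys_le S i j) x : sys_map ij x^-1 = (sys_map ij x)^-1.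
Proof. by apply: (mulgI (sys_map ij x)); rewrite -gmulfM !mulgV sys_map1. Qed.

Definition lim_one : inverseLimit := lim_mk (x := fun i => 1) (@sys_map1).

Lemma lim_mul_subproof (x y : inverseLimit) i j (ij : sys_le i j) :
  sys_map ij (lim_proj j x * lim_proj j y) = lim_proj i x * lim_proj i y.
Proof. by rewrite gmulfM !lim_projP. Qed.

Definition lim_mul (x y : inverseLimit) : inverseLimit :=
  lim_mk (@lim_mul_subproof x y).

Lemma lim_inv_subproof (x : inverseLimit) i j (ij : sys_le i j) :
  sys_map ij (lim_proj j x)^-1 = (lim_proj i x)^-1.
Proof. by rewrite sys_mapV lim_projP. Qed.

Definition lim_inv (x : inverseLimit) : inverseLimit :=
  lim_mk (@lim_inv_subproof x).

Lemma lim_mulA : associative lim_mul.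
Proof. by move=> x y z; apply: lim_ext => i; exact: mulgA. Qed.
Lemma lim_mul1 : left_id lim_one lim_mul.
Proof. by move=> x; apply: lim_ext => i; exact: mul1g. Qed.
Lemma lim_mulr1 : right_id lim_one lim_mul.
Proof. by move=> x; apply: lim_ext => i; exact: mulg1. Qed.
Lemma lim_mulV : left_inverse lim_one lim_inv lim_mul.
Proof. by move=> x; apply: lim_ext => i; exact: mulVg. Qed.
Lemma lim_mulrV : right_inverse lim_one lim_inv lim_mul.
Proof. by move=> x; apply: lim_ext => i; exact: mulgV. Qed.

HB.instance Definition _ :=
  isGroup.Build inverseLimit lim_mulA lim_mul1 lim_mulr1 lim_mulV lim_mulrV.

Lemma discrete_lim_proj i (x : inverseLimit) :
  nbhs x [set y | lim_proj i y = lim_proj i x].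
Proof.
have /cvg_sup/(_ i) cv : nbhs (set_val x : sys_product) --> (set_val x : sys_product).
  exact: cvg_id.
pose B : set (discrete_topology (sys_obj i)) := [set lim_proj i x].
apply: (@initial_continuous inverseLimit sys_product set_val x
  [set y : sys_product | B (y i)]).
apply: cv; apply: open_nbhs_nbhs; split => //.
by exists B => //; exact: discrete_open.
Qed.

Lemma continuous_lim (X : topologicalType) (f : X -> inverseLimit) :
  (forall i x, \forall y \near x, lim_proj i (f y) = lim_proj i (f x)) ->
  continuous f.
Proof.
move=> cf x.
have cv : (fun t => set_val (f t)) @ x --> (set_val (f x) : sys_product).
  apply/cvg_sup => i A [_ [[B oB <-] /= Bfx] BA].
  apply: filterS (cf i x) => y fyx; apply: BA => /=.
  by have : B (lim_proj i (f x)) by []; rewrite -fyx.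
move=> A [_ [[B oB <-] /= Bfx] BA].
apply: filterS BA _; apply: cv.
exact: open_nbhs_nbhs.
Qed.

Lemma lim_mulg_continuous :
  continuous (fun p : inverseLimit * inverseLimit => p.1 * p.2).
Proof.
apply: continuous_lim => i [x y].
exists ([set z | lim_proj i z = lim_proj i x], [set z | lim_proj i z = lim_proj i y]).
  by split; exact: discrete_lim_proj.
move=> [u v] /= [ux vy].
by rewrite -[LHS]/(lim_proj i u * lim_proj i v) ux vy.
Qed.

Lemma lim_invg_continuous : continuous (fun x : inverseLimit => x^-1).
Proof.
apply: continuous_lim => i x; apply: filterS (discrete_lim_proj i x) => y yx.
by rewrite -[LHS]/((lim_proj i y)^-1) yx.
Qed.

HB.instance Definition _ :=
  isTopologicalGroup.Build inverseLimit lim_mulg_continuous lim_invg_continuous.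

End InverseLimit.

Definition finite_index (G : groupType) (N : normalSubgroup G) : Prop :=
  finite_set [set: quotientGroup N].

Section Systems.
Variable G : groupType.

Section QuotientSystem.
Variables (I : Type) (le : I -> I -> Prop) (N : I -> normalSubgroup G).
Hypotheses (le_refl : forall i, le i i)
  (le_trans : forall i j k, le i j -> le j k -> le i k)
  (le_directed : forall i j, exists k, le i k /\ le j k)
  (leN : forall i j, le i j -> N j `<=` N i).

Lemma quotient_map_id i (ii : le i i) : qmap (leN ii) =1 id.
Proof. by move=> c; rewrite -(qreprK c) qmapE. Qed.

Lemma quotient_map_comp i j k (ij : le i j) (jk : le j k) (ik : le i k) :
  qmap (leN ij) \o qmap (leN jk) =1 qmap (leN ik).
Proof. by move=> c; rewrite -(qreprK c) /= !qmapE. Qed.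

(* The groups [G / N i] with the natural maps [G / N j -> G / N i]. *)
Definition quotientSystem : inverseSystem :=
  @InverseSystem I le le_refl le_trans le_directed
    (fun i => quotientGroup (N i))
    (fun i j ij => qmap (leN ij) : {multiplicative _ -> _})
    quotient_map_id quotient_map_comp.

End QuotientSystem.

Definition finiteIndexSubgroup := {N : normalSubgroup G | finite_index N}.

Definition revsub (N M : finiteIndexSubgroup) : Prop := sval M `<=` sval N.

Lemma revsub_refl N : revsub N N. Proof. exact: subset_refl. Qed.

Lemma revsub_trans N M P : revsub N M -> revsub M P -> revsub N P.
Proof. by move=> NM MP; exact: subset_trans MP NM. Qed.

Definition capN (N M : normalSubgroup G) : normalSubgroup G.
Proof.
exists (N `&` M).
- by split; exact: nset1.
- by move=> x y [Nx Mx] [Ny My]; split; exact: nsetM.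
- by move=> x [Nx Mx]; split; exact: nsetV.
- by move=> x y [Nx Mx]; split; exact: nsetJ.
Defined.

Lemma finite_index_capN N M :
  finite_index N -> finite_index M -> finite_index (capN N M).
Proof.
move=> fN fM.
have NMN : capN N M `<=` N by move=> x [].
have NMM : capN N M `<=` M by move=> x [].
pose h c := (qmap NMN c, qmap NMM c).
rewrite /finite_index.
have -> : [set: quotientGroup (capN N M)] = h @^-1` (setT `*` setT).
  by apply/seteqP; split.
apply: finite_preimage (finite_setX fN fM) => c d _ _.
rewrite /h -(qreprK c) -(qreprK d) !qmapE => -[/qprojP Ncd /qprojP Mcd].
exact/qprojP.
Qed.

Lemma revsub_directed N M : exists P, revsub N P /\ revsub M P.
Proof.
exists (exist _ _ (finite_index_capN (svalP N) (svalP M))).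
by split=> x [].
Qed.

Definition finiteQuotientSystem : inverseSystem :=
  @quotientSystem finiteIndexSubgroup revsub (fun N => sval N)
    revsub_refl revsub_trans revsub_directed (fun _ _ => id).

End Systems.

Definition profiniteCompletion (G : groupType) : topologicalGroupType :=
  inverseLimit (finiteQuotientSystem G).

Section FreeSolvable.
Variables m r : nat.

Let F : groupType := freeGroup 'I_m.

(* [freeSolvable] is Phi_r and [Phi n] is Phi_{r,n}. *)
Definition freeSolvable : groupType := quotientGroup (derived F r).
Definition Phi (n : nat) : groupType := quotientGroup (Kseries F r n).

Definition piPhi (n : nat) : {multiplicative freeSolvable -> Phi n} :=
  qmap (@derived_sub_Kseries F r n).

Definition posnat := {n : nat | (0 < n)%N}.
Definition posnat_dvd (n n' : posnat) : Prop := (val n %| val n')%N.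

Lemma posnat_dvd_refl n : posnat_dvd n n. Proof. exact: dvdnn. Qed.
Lemma posnat_dvd_trans n p q : posnat_dvd n p -> posnat_dvd p q -> posnat_dvd n q.
Proof. exact: dvdn_trans. Qed.
Lemma posnat_dvd_directed n p : exists q, posnat_dvd n q /\ posnat_dvd p q.
Proof.
have lcm_gt0 : (0 < lcmn (val n) (val p))%N.
  by rewrite lcmn_gt0 (valP n) (valP p).
by exists (exist (fun k => is_true (0 < k)%N) _ lcm_gt0); split; [exact: dvdn_lcml | exact: dvdn_lcmr].
Qed.

Definition PhiSystem : inverseSystem :=
  @quotientSystem F posnat posnat_dvd (fun n => Kseries F r (val n))
    posnat_dvd_refl posnat_dvd_trans posnat_dvd_directed
    (fun n n' nn' => @KseriesS F r (val n) (val n') nn').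

Definition limPhi : topologicalGroupType := inverseLimit PhiSystem.

End FreeSolvable.

(* Main.v *)
Require Import Defs.
From HB Require Import structures.
From mathcomp Require Import all_boot fingroup.
From mathcomp Require Import all_classical topology.

(** Both halves of the statement come down to comparing the series K_{s,n}
    with the derived series, and to the finiteness of Phi_{r,n}.

    Factorization. Let h be a morphism from F to a group H in which every n-th
    power is trivial. Passing from F^(s) to K_{s,n} only adds commutators of
    elements already present and n-th powers, and the latter die in H; so, by
    induction on s, h maps K_{s,n} into h(F^(s)) ([Kseries_image]). If h comes
    from Phi_r, it kills F^(r), hence also K_{r,n}, hence factors through
    Phi_{r,n} ([Kseries_factor]). By Lagrange this applies to H = G whenever
    the order of G divides n.

    Finiteness. Each K_{s,n} with n > 0 has finite index in F
    ([finite_index_Kseries]). Indeed, if K_{s,n} has finite index, it is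
    finitely generated by Schreier's lemma ([schreier]), and then
    K_{s,n} / K_{s+1,n} is a finitely generated abelian group of exponent
    dividing n, hence finite ([finite_abelian_torsion]).

    Completion. The kernels of Phi_r -> Phi_{r,n} thus are normal subgroups of
    finite index, and by the factorization every normal subgroup of finite
    index contains one of them: a finite group has some exponent n > 0
    ([finite_group_exponent]). So the groups Phi_{r,n} form a cofinal part of
    the system of all finite quotients of Phi_r, and a cofinal part has the
    same limit ([profiniteCompletion_cofinal]). *)

Set Implicit Arguments.
Unset Strict Implicit.
Unset Printing Implicit Defensive.

Import Algebra.
Local Open Scope classical_set_scope.
Local Open Scope group_scope.

Local Notation generated := Defs.generated.

(** * Morphisms, quotients and subgroups *)

Section GroupMorphism.
Variables (G H : groupType) (h : {multiplicative G -> H}).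

Lemma gmorph1 : h 1 = 1.
Proof. by apply: (mulgI (h 1)); rewrite -gmulfM !mulg1. Qed.

Lemma gmorphV : {morph h : x / x^-1}.
Proof. by move=> x; apply: (mulgI (h x)); rewrite -gmulfM !mulgV gmorph1. Qed.

Lemma gmorphXn n : {morph h : x / x ^+ n}.
Proof.
by move=> x; elim: n => [|n IH]; [exact: gmorph1 | rewrite !expgS gmulfM IH].
Qed.

Lemma gmorphJ : {morph h : x y / x ^ y}.
Proof. by move=> x y; rewrite /conjg !gmulfM gmorphV. Qed.

Lemma gmorphR : {morph h : x y / [~ x, y]}.
Proof. by move=> x y; rewrite !commgEl gmulfM gmorphV gmorphJ. Qed.

End GroupMorphism.

Section Factor.
Variables (G H : groupType) (N : normalSubgroup G).
Variable h : {multiplicative G -> H}.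
Hypothesis hN : forall x, nset N x -> h x = 1.

(** The morphism induced by h on G / N. The proof that h kills N is an argument
    because the function is multiplicative only in its presence. *)
Definition qfactor of (forall x, nset N x -> h x = 1) :=
  fun c : quotientGroup N => h (qrepr c).

Lemma qfactorE x : qfactor hN (qproj N x) = h x.
Proof.
apply: (mulgI (h (qrepr (qproj N x)))^-1).
by rewrite mulVg -gmorphV -gmulfM hN//; exact: qrepr_qproj.
Qed.

Lemma qfactor_mulg : {morph qfactor hN : c d / c * d}.
Proof.
move=> c d; rewrite -(qreprK c) -(qreprK d).
by rewrite -qproj_mulg !qfactorE gmulfM.
Qed.

HB.instance Definition _ := isMultiplicative.Build
  (quotientGroup N) H (qfactor hN) qfactor_mulg.

End Factor.

Section Kernel.
Variables (G H : groupType) (h : {multiplicative G -> H}).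

Definition kerN : normalSubgroup G.
Proof.
exists [set x | h x = 1] => /=.
- exact: gmorph1.
- by move=> x y hx hy; rewrite gmulfM hx hy mulg1.
- by move=> x hx; rewrite gmorphV hx invg1.
- by move=> x y hx; rewrite gmorphJ hx conj1g.
Defined.

(** G / ker h embeds in H. *)
Lemma finite_index_kerN : finite_set [set: H] -> finite_index kerN.
Proof.
move=> finH; pose k := qfactor (fun x (hx : nset kerN x) => hx).
rewrite /finite_index; have -> : [set: quotientGroup kerN] = k @^-1` setT by [].
apply: finite_preimage finH => c d _ _.
rewrite /k -(qreprK c) -(qreprK d) !qfactorE => hcd.
by apply/qprojP; rewrite /= gmulfM gmorphV hcd mulVg.
Qed.

End Kernel.

Section Subgroups.
Variables (G H : groupType) (h : {multiplicative G -> H}).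

Lemma nset_subgroup (N : normalSubgroup G) : is_subgroup N.
Proof. by split; [exact: nset1 | exact: nsetM | exact: nsetV]. Qed.

Lemma preimage_subgroup (B : set H) : is_subgroup B -> is_subgroup (h @^-1` B).
Proof.
move=> [B1 BM BV]; split=> /= [|x y Bx By|x Bx];
  by rewrite ?gmorph1 ?gmulfM ?gmorphV; auto.
Qed.

Lemma image_subgroup (A : set G) : is_subgroup A -> is_subgroup (h @` A).
Proof.
move=> [A1 AM AV]; split.
- by exists 1; [|exact: gmorph1].
- move=> _ _ [x Ax <-] [y Ay <-].
  by exists (x * y); [exact: AM | exact: gmulfM].
- by move=> _ [x Ax <-]; exists x^-1; [exact: AV | exact: gmorphV].
Qed.

Lemma image_generated (A : set G) : h @` generated A = generated (h @` A).
Proof.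
apply/seteqP; split; last first.
  apply: generated_min; first by apply: image_subgroup; exact: generated_subgroup.
  by apply: image_subset; exact: sub_generated.
move=> _ [x Ax <-]; move: x Ax.
apply: (generated_min (H := h @^-1` generated (h @` A))).
  by apply: preimage_subgroup; exact: generated_subgroup.
by move=> a Aa; apply: sub_generated; exists a.
Qed.

End Subgroups.

Lemma qproj_eq1 (G : groupType) (N : normalSubgroup G) x :
  qproj N x = 1 <-> nset N x.
Proof.
have -> : (1 : quotientGroup N) = qproj N 1 by [].
split=> [/qprojP|Nx]; last apply/qprojP; rewrite mulg1.
  by move/(@nsetV _ N); rewrite invgK.
exact: nsetV.
Qed.

(** * Finite quotients and the series K_{s,n} *)

(** Seen through h, the n-th powers adjoined at each step are invisible, so
    K_{s,n} has the same image as G^(s): by induction the two entries of a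
    commutator can be replaced by elements of the derived subgroup. *)
Lemma Kseries_image (G H : groupType) (h : {multiplicative G -> H}) n :
  (forall y : H, y ^+ n = 1) ->
  forall s, Kseries G s n `<=` h @^-1` (h @` derived G s).
Proof.
move=> Hn; elim=> [|s IH]; first by move=> x _; exists x.
have sP := preimage_subgroup h (image_subgroup h (nset_subgroup (derived G s.+1))).
have [P1 PM _] := sP.
move=> _ [a [b [Ka Kb ->]]]; apply: PM.
  apply: (generated_min sP) Ka => _ [u [v [/IH[u' Du hu] /IH[v' Dv hv] ->]]].
  exists [~ u', v']; last by rewrite !gmorphR hu hv.
  by apply: sub_generated; exists u', v'.
apply: (generated_min sP) Kb => _ [u _ <-].
by rewrite /= gmorphXn Hn -(gmorph1 h); exact: P1.
Qed.

(** The powers of an element of a finite group cannot be all distinct, so every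
    element has finite order; the product of the orders is an exponent. *)
Lemma finite_group_exponent (H : groupType) :
  finite_set [set: H] -> exists2 n, (0 < n)%N & forall x : H, x ^+ n = 1.
Proof.
move=> finH.
have ord (x : H) : exists2 n, (0 < n)%N & x ^+ n = 1.
  have : ~ injective (fun i : nat => x ^+ i).
    move=> inj; apply: infinite_nat.
    by apply: (@finite_preimage _ _ _ (fun i : nat => x ^+ i)) finH => i j _ _ /inj.
  move/existsNP => [i] /existsNP[j] /not_implyP[xij /eqP ij].
  wlog ltij : i j xij ij / (i < j)%N.
    by move=> W; move: (ij); rewrite neq_ltn => /orP[] ?;
       [apply: (W i j) | apply: (W j i) => //; rewrite eq_sym].
  exists (j - i)%N; first by rewrite subn_gt0.
  by rewrite expgnFr ?(ltnW ltij)// -xij mulgV.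
have [s sE] := (finite_seqP _).1 finH.
suff [n n0 ns] : exists2 n, (0 < n)%N & forall x : H, x \in s -> x ^+ n = 1.
  exists n => // x; apply: ns.
  by have : [set: H] x by []; rewrite sE.
elim: s {sE} => [|a s [n n0 ns]]; first by exists 1%N.
have [k k0 ak] := ord a; exists (k * n)%N; first by rewrite muln_gt0 k0.
move=> x; rewrite inE => /orP[/eqP->|/ns xn]; first by rewrite expgnA ak expg1n.
by rewrite mulnC expgnA xn expg1n.
Qed.

(** * Finiteness of the quotients by K_{r,n} *)

Section Finiteness.
Variable G : groupType.

Definition finitely_generated (H : set G) :=
  exists2 A : set G, finite_set A & H = generated A.

(** Let t(c) be a representative of each coset c of N. The elements
    gamma(g, c) = t(gc)^-1 g t(c) of N satisfy the cocycle identity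
    gamma(gh, c) = gamma(g, hc) gamma(h, c). So the g for which all gamma(g, c)
    lie in the subgroup generated by the gamma(a, c), a in A, form a subgroup;
    it contains A, hence is everything. Finally every element of N is of the
    form gamma(g, 1). *)
Lemma schreier (N : normalSubgroup G) :
  finitely_generated setT -> finite_index N -> finitely_generated N.
Proof.
move=> [A finA GA] finN.
pose gamma g (c : quotientGroup N) := (qrepr (qproj N g * c))^-1 * g * qrepr c.
pose B := [set gamma a c | a in A & c in setT].
have finB : finite_set B by exact: finite_image2.
have sB := generated_subgroup B; have [B1 BM BV] := sB.
have gamma_N g c : nset N (gamma g c).
  by apply/qproj_eq1; rewrite !qproj_mulg gmorphV /= !qreprK -mulgA mulVg.
exists B => //; apply/seteqP; split; last first.
  apply: generated_min; last by move=> _ [a _ [c _ <-]]; exact: gamma_N.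
  exact: nset_subgroup.
pose P := [set g | forall c, generated B (gamma g c)].
have PT g : P g.
  have : generated A g by rewrite -GA.
  apply: (generated_min (H := P)) g; last first.
    by move=> a Aa c; apply: sub_generated; exists a => //; exists c.
  split.
  - by move=> c; rewrite /gamma gmorph1 mul1g mulg1 mulVg.
  - move=> g h Pg Ph c.
    have -> : gamma (g * h) c = gamma g (qproj N h * c) * gamma h c.
      by rewrite /gamma gmulfM !mulgA mulgK.
    exact: BM.
  - move=> g Pg c.
    have -> : gamma g^-1 c = (gamma g (qproj N g^-1 * c))^-1.
      by rewrite /gamma gmorphV mulVKg !invgM !invgK !mulgA.
    exact: BV.
(* The representative t of the trivial coset need not be 1: it is only an
   element of N, and conjugation by it has to be undone. *)
move=> g Ng; pose t := qrepr (1 : quotientGroup N).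
have -> : g = gamma (t * g * t^-1) 1; last exact: PT.
have Nt : nset N t by apply/qproj_eq1; rewrite qreprK.
have -> : gamma (t * g * t^-1) 1 = t^-1 * (t * g * t^-1) * t.
  rewrite /gamma mulg1.
  by have /qproj_eq1-> : nset N (t * g * t^-1) by apply: nsetM; [exact: nsetM|exact: nsetV].
by rewrite -!mulgA mulVg mulg1 mulKg.
Qed.

(** Generators are adjoined one at a time: if B is a finite subgroup of H and a
    is in H, then the products a^i b with b in B form a subgroup, as H is
    abelian, and i < n suffices, as a^n = 1. *)
Lemma finite_abelian_torsion (H : set G) n :
  is_subgroup H -> (forall x y, H x -> H y -> commute x y) ->
  (0 < n)%N -> (forall x, H x -> x ^+ n = 1) ->
  finitely_generated H -> finite_set H.
Proof.
move=> [H1 HM HV] Hab n0 Hn [A finA HA].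
have AH : A `<=` H by rewrite HA; exact: sub_generated.
suff [B [finB sB _ AB]] :
    exists B : set G, [/\ finite_set B, is_subgroup B, B `<=` H & A `<=` B].
  by apply: sub_finite_set finB; rewrite HA; exact: generated_min.
have [s sA] := (finite_seqP _).1 finA.
elim: s A sA AH {HA finA} => [|a s IH] A -> AH.
  exists [set 1]; split; [exact: finite_set1| |by move=> x ->|by []].
  by split=> // [x y -> ->|x ->] /=; rewrite ?mulg1 ?invg1.
have [|B [finB [B1 BM BV] BH sB]] := IH _ erefl.
  by move=> x /= xs; apply: AH; rewrite /= inE xs orbT.
have Ha : H a by apply: AH; rewrite /= inE eqxx.
have cB x i : B x -> commute x (a ^+ i).
  by move=> /BH Hx; exact/commuteX/Hab.
exists [set a ^+ i * b | i in [set: nat] & b in B]; split.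
- apply: (@sub_finite_set _ _ [set a ^+ i * b | i in `I_n & b in B]).
    move=> _ [i _ [b Bb <-]]; exists (i %% n)%N; first exact: ltn_pmod.
    exists b => //; rewrite {2}(divn_eq i n) expgnDr mulnC expgnA Hn//.
    by rewrite expg1n mul1g.
  by apply: finite_image2 => //; exact: finite_II.
- split.
  + by exists 0%N => //; exists 1 => //; rewrite mulg1.
  + move=> _ _ [i _ [b Bb <-]] [j _ [c Bc <-]].
    exists (i + j)%N => //; exists (b * c); first exact: BM.
    by rewrite expgnDr -!mulgA; congr (_ * _); rewrite !mulgA (cB b).
  + move=> _ [i _ [b Bb <-]].
    (* As a^n = 1, the inverse of a^i is the positive power a^((n - 1) i). *)
    exists (n.-1 * i)%N => //; exists b^-1; first exact: BV.
    rewrite -(cB _ _ (BV _ Bb)) invgM; congr (_ * _).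
    apply: (mulIg (a ^+ i)); rewrite -expgnDr mulVg -mulSnr prednK//.
    by rewrite expgnA Hn// expg1n.
- move=> _ [i _ [b /BH Hb <-]]; apply: (HM) => //.
  by elim: i => [|i IHi]; [exact: H1 | rewrite expgS; exact: HM].
- move=> x; rewrite /= inE => /orP[/eqP->|xs].
    by exists 1%N => //; exists 1 => //; rewrite mulg1.
  by exists 0%N => //; exists x; [exact: sB | rewrite mul1g].
Qed.

End Finiteness.

(** An element g of G is the chosen representative of gN times an element of N,
    so G / M is covered by finitely many translates of the image of N. *)
Lemma finite_index_tower (G : groupType) (M N : normalSubgroup G) :
  M `<=` N -> finite_index N -> finite_set (qproj M @` N) -> finite_index M.
Proof.
move=> MN finN finNM.
apply: sub_finite_set (finite_image2
  (fun (c : quotientGroup N) h => qproj M (qrepr c) * h) finN finNM).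
move=> c _; pose g := qrepr c; exists (qproj N g) => //.
exists (qproj M ((qrepr (qproj N g))^-1 * g)).
  by exists ((qrepr (qproj N g))^-1 * g) => //; exact: qrepr_qproj.
by rewrite -qproj_mulg mulVKg qreprK.
Qed.

Lemma finite_index_Kseries_step (G : groupType) (N : normalSubgroup G) n :
  (0 < n)%N -> finitely_generated [set: G] -> finite_index N ->
  finite_index (mulN (commutatorN N) (powerN N n)).
Proof.
move=> n0 fgG finN; set M := mulN _ _.
have MC x : nset (commutatorN N) x -> nset M x.
  by move=> Cx; exists x, 1; split; rewrite ?mulg1//; exact: nset1.
have MX x : nset (powerN N n) x -> nset M x.
  by move=> Px; exists 1, x; split; rewrite ?mul1g//; exact: nset1.
have sN := nset_subgroup N.
have MN : M `<=` N.
  move=> _ [a [b [Ca Pb ->]]]; apply: nsetM.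
    apply: (generated_min sN) Ca => _ [x [y [Nx Ny ->]]].
    rewrite commgEl; apply: nsetM; [exact: nsetV | exact: nsetJ].
  apply: (generated_min sN) Pb => _ [x Nx <-].
  by elim: n {M MC MX n0} => [|n IH]; [exact: nset1 | rewrite expgS; exact: nsetM].
apply: (finite_index_tower MN finN).
have [A finA NA] := schreier fgG finN.
apply: (@finite_abelian_torsion _ _ n) => //.
- by apply: image_subgroup; exact: nset_subgroup.
- move=> _ _ [x Nx <-] [y Ny <-]; apply/monoid.commgP/eqP; rewrite -gmorphR.
  by apply/qproj_eq1/MC; apply: sub_generated; exists x, y.
- move=> _ [x Nx <-]; rewrite -gmorphXn.
  by apply/qproj_eq1/MX; apply: sub_generated; exists x.
- exists (qproj M @` A); first exact: finite_image.
  by rewrite NA; exact: image_generated.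
Qed.

Lemma finite_index_Kseries (G : groupType) r n :
  (0 < n)%N -> finitely_generated [set: G] -> finite_index (Kseries G r n).
Proof.
move=> n0 fgG; elim: r => [|r IH]; last exact: finite_index_Kseries_step.
apply: (@sub_finite_set _ _ [set 1]); last exact: finite_set1.
by move=> c _; rewrite -(qreprK c); apply/qproj_eq1.
Qed.

Lemma freeGroup_finitely_generated (T : finType) :
  finitely_generated [set: freeGroup T].
Proof.
exists (@fgen T @` setT); first by apply: finite_image; exact: finite_finset.
have [g1 gM gV] := generated_subgroup (@fgen T @` setT).
apply/seteqP; split=> // c _; rewrite -(freprK c).
elim: (frepr c) => [//|[t b] w IH].
have -> : fclass ((t, b) :: w) = fclass [:: (t, b)] * fclass w.
  by rewrite [RHS]fmulE.
have gt : generated (@fgen T @` setT) (fgen t).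
  by apply: sub_generated; exists t.
apply: gM => //; case: b => //.
have -> : fclass [:: (t, false)] = (fgen t)^-1 by rewrite [RHS]finvE.
exact: gV.
Qed.

(** * The profinite completion as the limit of a cofinal system *)

(** The normal subgroups K i of G contain D, and their images in Q = G / D are
    cofinal among the normal subgroups of finite index. The quotients G / K i
    are quotients of G rather than of Q; they are related to the system of
    finite quotients of Q through the kernel of Q -> G / K i. *)
Section CofinalSystem.
Variables (G : groupType) (D : normalSubgroup G).
Variables (I : Type) (le : I -> I -> Prop) (K : I -> normalSubgroup G).
Hypotheses (le_refl : forall i, le i i)
  (le_trans : forall i j k, le i j -> le j k -> le i k)
  (le_directed : forall i j, exists k, le i k /\ le j k)
  (leK : forall i j, le i j -> K j `<=` K i).
Hypotheses (DK : forall i, D `<=` K i) (finK : forall i, finite_index (K i)).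

Let Q : groupType := quotientGroup D.
Let S : inverseSystem := finiteQuotientSystem Q.
Let T : inverseSystem := quotientSystem le_refl le_trans le_directed leK.

Definition dominates i (N : normalSubgroup Q) : Prop :=
  K i `<=` qproj D @^-1` N.

Hypothesis cofK : forall N : normalSubgroup Q, finite_index N ->
  exists i, dominates i N.

Definition level_ker i : finiteIndexSubgroup Q :=
  exist _ (kerN (qmap (DK i))) (@finite_index_kerN _ _ (qmap (DK i)) (finK i)).

(** The isomorphism from Q / ker (Q -> G / K i) to G / K i. *)
Definition from_level i : quotientGroup (kerN (qmap (DK i))) -> quotientGroup (K i) :=
  @qfactor _ _ (kerN (qmap (DK i))) (qmap (DK i)) (fun x hx => hx).

Lemma from_levelE i x :
  from_level (qproj (kerN (qmap (DK i))) (qproj D x)) = qproj (K i) x.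
Proof. by rewrite /from_level qfactorE /= qmapE. Qed.

Lemma dominates_ker i (N : normalSubgroup Q) : dominates i N ->
  forall x, nset (K i) x -> (qproj N \o qproj D) x = 1.
Proof. by move=> iN x /iN Nx; apply/qproj_eq1. Qed.

Definition to_level i (N : normalSubgroup Q) (iN : dominates i N) :
    quotientGroup (K i) -> quotientGroup N :=
  qfactor (dominates_ker iN).

Lemma to_levelE i N (iN : dominates i N) x :
  to_level iN (qproj (K i) x) = qproj N (qproj D x).
Proof. by rewrite /to_level qfactorE. Qed.

Lemma qprojqK (N : normalSubgroup Q) (c : quotientGroup N) :
  exists x, c = qproj N (qproj D x).
Proof. by exists (qrepr (qrepr c)); rewrite !qreprK. Qed.

(** Two levels above N have a common refinement, so the component at N of a
    compatible family can be read off at any of them. This is what makes the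
    arbitrary choice of [level] harmless. *)
Lemma to_level_indep i j N (iN : dominates i N) (jN : dominates j N)
    (y : inverseLimit T) :
  to_level iN (@lim_proj T i y) = to_level jN (@lim_proj T j y).
Proof.
have [k [ik jk]] := le_directed i j.
rewrite -(@lim_projP T y i k ik) -(@lim_projP T y j k jk) /=.
by rewrite -(qreprK (@lim_proj T k y)) !qmapE !to_levelE.
Qed.

Lemma level_dominates i : dominates i (kerN (qmap (DK i))).
Proof. by move=> x Kx; rewrite /= qmapE; apply/qproj_eq1. Qed.

Lemma level_kerS i j (ij : le i j) :
  kerN (qmap (DK j)) `<=` kerN (qmap (DK i)).
Proof.
move=> c; rewrite -(qreprK c) /= !qmapE => /qproj_eq1 Kj.
by apply/qproj_eq1; exact: leK Kj.
Qed.

Lemma level_ker_sub i N : dominates i N -> kerN (qmap (DK i)) `<=` N.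
Proof. by move=> iN c; rewrite -(qreprK c) /= qmapE => /qproj_eq1; exact: iN. Qed.

Lemma from_level_natural i j (ij : le i j) (c : quotientGroup (kerN (qmap (DK j)))) :
  qmap (leK ij) (from_level c) = from_level (qmap (level_kerS ij) c).
Proof. by have [g ->] := qprojqK c; rewrite from_levelE !qmapE from_levelE. Qed.

Lemma to_level_natural i (N M : normalSubgroup Q) (NM : M `<=` N) (iM : dominates i M)
    (iN : dominates i N) (c : quotientGroup (K i)) :
  qmap NM (to_level iM c) = to_level iN c.
Proof. by rewrite -(qreprK c) !to_levelE qmapE. Qed.

Lemma from_levelK i N (iN : dominates i N) (c : quotientGroup (kerN (qmap (DK i)))) :
  to_level iN (from_level c) = qmap (level_ker_sub iN) c.
Proof. by have [g ->] := qprojqK c; rewrite from_levelE to_levelE qmapE. Qed.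

Lemma to_levelK i : cancel (to_level (@level_dominates i)) (@from_level i).
Proof. by move=> c; rewrite -(qreprK c) to_levelE from_levelE. Qed.

Definition completion_to_lim_fun (x : inverseLimit S) (i : sys_index T) :
    sys_obj i :=
  from_level (@lim_proj S (level_ker i) x).

Lemma completion_to_lim_compatible x i j (ij : @sys_le T i j) :
  sys_map ij (completion_to_lim_fun x j) = completion_to_lim_fun x i.
Proof.
rewrite /completion_to_lim_fun.
rewrite -(lim_projP x (level_kerS ij : @sys_le S (level_ker i) (level_ker j))).
exact: from_level_natural.
Qed.

Definition completion_to_lim (x : profiniteCompletion Q) : inverseLimit T :=
  lim_mk (completion_to_lim_compatible x).

Definition level (N : finiteIndexSubgroup Q) : I :=
  sval (cid (cofK (svalP N))).

Lemma levelP N : dominates (level N) (sval N).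
Proof. exact: svalP (cid (cofK (svalP N))). Qed.

Definition lim_to_completion_fun (y : inverseLimit T) (N : sys_index S) :
    sys_obj N :=
  to_level (@levelP N) (@lim_proj T (level N) y).

Lemma lim_to_completion_compatible y N M (NM : @sys_le S N M) :
  sys_map NM (lim_to_completion_fun y M) = lim_to_completion_fun y N.
Proof.
have MN : dominates (level M) (sval N).
  by move=> x /levelP Mx; exact: NM.
rewrite /lim_to_completion_fun (to_level_indep (@levelP N) MN).
exact: to_level_natural.
Qed.

Definition lim_to_completion (y : inverseLimit T) : profiniteCompletion Q :=
  lim_mk (lim_to_completion_compatible y).

Lemma completion_to_lim_mulg : {morph completion_to_lim : x y / x * y}.
Proof. by move=> x y; apply: lim_ext => i; exact: qfactor_mulg. Qed.

Lemma lim_to_completion_mulg : {morph lim_to_completion : x y / x * y}.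
Proof. by move=> x y; apply: lim_ext => N; exact: qfactor_mulg. Qed.

HB.instance Definition _ := isMultiplicative.Build
  (profiniteCompletion Q) (inverseLimit T) completion_to_lim
  completion_to_lim_mulg.

HB.instance Definition _ := isMultiplicative.Build
  (inverseLimit T) (profiniteCompletion Q) lim_to_completion
  lim_to_completion_mulg.

Lemma completion_to_limK : cancel completion_to_lim lim_to_completion.
Proof.
move=> x; apply: lim_ext => N.
rewrite -(lim_projP x
  (level_ker_sub (@levelP N) : @sys_le S N (level_ker (level N)))).
exact: from_levelK.
Qed.

Lemma lim_to_completionK : cancel lim_to_completion completion_to_lim.
Proof.
move=> y; apply: lim_ext => i.
rewrite -[LHS]/(from_level (to_level (@levelP (level_ker i))
  (@lim_proj T (level (level_ker i)) y))).
by rewrite (to_level_indep _ (@level_dominates i)) to_levelK.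
Qed.

(** Each component of either map depends on a single component of its argument,
    whence the continuity. *)
Lemma profiniteCompletion_cofinal :
  topologically_isomorphic (profiniteCompletion Q) (inverseLimit T).
Proof.
exists (completion_to_lim : {multiplicative _ -> _}).
exists (lim_to_completion : {multiplicative _ -> _}).
split; [exact: completion_to_limK | exact: lim_to_completionK | |].
- apply: continuous_lim => i x.
  apply: filterS (@discrete_lim_proj S (level_ker i) x) => z /= zx.
  exact: (congr1 (@from_level i) zx).
- apply: continuous_lim => N y.
  apply: filterS (@discrete_lim_proj T (level N) y) => z /= zy.
  exact: (congr1 (to_level (@levelP N)) zy).
Qed.

End CofinalSystem.

(** * Free solvable groups *)

Lemma Kseries_factor (G H : groupType) r n
    (p : {multiplicative quotientGroup (derived G r) -> H}) :
  (forall y : H, y ^+ n = 1) ->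
  Kseries G r n `<=` (p \o qproj (derived G r)) @^-1` [set 1].
Proof.
move=> Hn x /(Kseries_image (p \o qproj _) Hn)[y Dy pxy].
apply: (etrans (esym pxy)) => /=.
by have /qproj_eq1-> := Dy; exact: gmorph1.
Qed.

Theorem proposition3p7 (m r : nat) (hm : (2 <= m)%N) :
  (forall (n : nat), (0 < n)%N ->
   forall (G : finGroupType) (p : {multiplicative freeSolvable m r -> G}),
     (forall y : G, exists x : freeSolvable m r, p x = y) ->
     (#|G| %| n)%N ->
     exists q : {multiplicative Phi m r n -> G}, q \o piPhi m r n =1 p) /\
  topologically_isomorphic
    (profiniteCompletion (freeSolvable m r)) (limPhi m r).
Proof.
split=> [n n0 G p _ Gn|].
  have Hn (y : G) : y ^+ n = 1.
    have /dvdnP[k ->] : (#[y]%g %| n)%N.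
      apply: dvdn_trans Gn; rewrite -cardsT.
      exact: (@cardSg _ [set: G]%G <[y]>%G (finset.subsetT _)).
    by rewrite mulnC expgnA expg_order expg1n.
  exists (qfactor (Kseries_factor p Hn) : {multiplicative _ -> _}) => c.
  by rewrite -[in RHS](qreprK c); exact: (qfactorE (Kseries_factor p Hn) (qrepr c)).
pose F : groupType := freeGroup 'I_m.
apply: (@profiniteCompletion_cofinal F (derived F r) posnat posnat_dvd
  (fun n => Kseries F r (val n)) posnat_dvd_refl posnat_dvd_trans
  posnat_dvd_directed (fun n n' nn' => @KseriesS F r (val n) (val n') nn')).
- by move=> n; exact: derived_sub_Kseries.
- move=> n; apply: finite_index_Kseries; first exact: valP.
  exact: freeGroup_finitely_generated.
- move=> N /finite_group_exponent[n n0 Hn].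
  exists (exist (fun k => is_true (0 < k)%N) n n0) => x.
  by move=> /(Kseries_factor (qproj N) Hn) /= /qproj_eq1.
Qed.
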